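(* Let $d\ge1$, $E_2=\{\mu\in\mathbb{R}^d:\mu_i\ge0,\ \sum_i\mu_i=1\}$ (write $\mu(a)=\mu_a$), and let $v:\{1,\dots,d\}\times\{1,\dots,d\}\times E_2\to[0,\infty)$ be a continuous function such that for each $a,b$ the map $\mu\mapsto v(a,b,\mu)$ is either identically equal to zero or satisfies the following two properties: (a) $v(a,b,\mu)>0$ for all $\mu$ such that $\mu(a)>0$; (b) for every $\nu\in E_2$ such that $\nu(a)=0$, we have $v(a,b,\nu)=0$, and there exists a neighbourhood $U_\nu$ of $\nu$ on which there exists a decomposition $v(a,b,\mu)=v_{\nu,\dagger}(a,b,\mu(a))\,v_{\nu,\ddagger}(a,b,\mu)$ such that $v_{\nu,\dagger}$ is increasing in the third coordinate and such that $v_{\nu,\ddagger}(a,b,\cdot)$ is continuous and satisfies $v_{\nu,\ddagger}(a,b,\nu)\neq0$. Let $H:E_2\times\mathbb{R}^d\to\mathbb{R}$ be given by $$H(\mu,p)=\sum_{a,b=1}^d v(a,b,\mu)\left[e^{p_b-p_a}-1\right].$$ Then, for every $\lambda>0$ and $h\in C(E_2)$, the comparison principle holds for the equation $f(\mu)-\lambda H(\mu,\nabla f(\mu))-h(\mu)=0$ on $E_2$.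
   Context: For a compact set $E\subseteq\mathbb{R}^d$, $C(E)$ denotes the continuous real functions on $E$ and $C^1(E)$ the functions that are continuously differentiable on a neighbourhood of $E$ in $\mathbb{R}^d$. For a continuous $H:E\times\mathbb{R}^d\to\mathbb{R}$, $\lambda>0$ and $h\in C(E)$ consider the equation $$f(x)-\lambda H(x,\nabla f(x))-h(x)=0,\qquad x\in E. \quad ( * )$$ A function $u:E\to\mathbb{R}$ is a (viscosity) subsolution of $( * )$ if $u$ is bounded and upper semi-continuous and, for every $f\in C^1(E)$ and $x\in E$ such that $u-f$ has a maximum (over $E$) at $x$, one has $u(x)-\lambda H(x,\nabla f(x))-h(x)\le0$. A function $w:E\to\mathbb{R}$ is a (viscosity) supersolution of $( * )$ if $w$ is bounded and lower semi-continuous and, for every $f\in C^1(E)$ and $x\in E$ such that $w-f$ has a minimum (over $E$) at $x$, one has $w(x)-\lambda H(x,\nabla f(x))-h(x)\ge0$. Equation $( * )$ satisfies the comparison principle if $u\le w$ on $E$ for every subsolution $u$ and every supersolution $w$. *)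

(* Defs.v *)
(* Analysis is MathComp-Analysis over an abstract [R : realType]; points of
   R^d are row vectors ['rV[R]_d].  A function on [E] is represented by a total
   function on ['rV[R]_d] of which only the restriction to [E] is ever used. *)
From HB Require Import structures.
From mathcomp Require Import all_boot all_order all_algebra.
From mathcomp Require Import all_classical all_reals all_analysis.

Set Implicit Arguments.
Unset Strict Implicit.
Unset Printing Implicit Defensive.

Import Order.TTheory GRing.Theory Num.Theory.
Import numFieldNormedType.Exports.

Local Open Scope classical_set_scope.
Local Open Scope ring_scope.

(* Mirror image of the library's [lower_semicontinuous]. *)
Definition upper_semicontinuous (X : topologicalType) (R : numFieldType)
    (f : X -> \bar R) : Prop :=
  forall x a, (f x < a%:E)%E ->
    exists2 V, nbhs x V & forall y, V y -> (f y < a%:E)%E.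

Section viscosity.
Variables (R : realType) (d : nat).
Implicit Types (E : set 'rV[R]_d) (f u w h : 'rV[R]_d -> R).

Definition gradient f (x : 'rV[R]_d) : 'rV[R]_d :=
  \row_i 'D_(delta_mx 0 i) f x.

Definition C1_near E f : Prop :=
  exists U : set 'rV[R]_d,
    [/\ open U, E `<=` U,
        forall x, U x -> differentiable f x &
        forall x, U x -> {for x, continuous (gradient f)}].

(* Semicontinuity is relative to [E]: [subspace E] carries the trace topology
   at the points of [E] and isolates every point outside of [E]. *)
Definition viscosity_subsolution E (H : 'rV[R]_d -> 'rV[R]_d -> R)
    (lambda : R) h u : Prop :=
  [/\ [bounded u x | x in E],
      upper_semicontinuous (fun x : subspace E => (u x)%:E) &
      forall f x, C1_near E f -> E x ->
        (forall y, E y -> u y - f y <= u x - f x) ->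
        u x - lambda * H x (gradient f x) - h x <= 0].

Definition viscosity_supersolution E (H : 'rV[R]_d -> 'rV[R]_d -> R)
    (lambda : R) h w : Prop :=
  [/\ [bounded w x | x in E],
      lower_semicontinuous (fun x : subspace E => (w x)%:E) &
      forall f x, C1_near E f -> E x ->
        (forall y, E y -> w x - f x <= w y - f y) ->
        0 <= w x - lambda * H x (gradient f x) - h x].

Definition comparison_principle E (H : 'rV[R]_d -> 'rV[R]_d -> R)
    (lambda : R) h : Prop :=
  forall u w, viscosity_subsolution E H lambda h u ->
    viscosity_supersolution E H lambda h w ->
    forall x, E x -> u x <= w x.

Definition prob_simplex : set 'rV[R]_d :=
  [set mu | (forall i, 0 <= mu 0 i) /\ \sum_i mu 0 i = 1].

(* [vab] is the rate mu |-> v(a,b,mu); [vdag] and [vddag] are the two factors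
   of its decomposition near [nu].  [vdag] is nondecreasing, and only on the
   values taken by the coordinate mu(a) on the (relative) neighbourhood. *)
Definition rate_decomposition (a : 'I_d) (vab : 'rV[R]_d -> R)
    (nu : 'rV[R]_d) : Prop :=
  exists (U : set 'rV[R]_d) (vdag : R -> R) (vddag : 'rV[R]_d -> R),
    [/\ nbhs nu U,
        forall mu, (U `&` prob_simplex) mu ->
          vab mu = vdag (mu 0 a) * vddag mu,
        {in [set mu 0 a | mu in U `&` prob_simplex] &,
          {homo vdag : s t / s <= t}},
        {within U `&` prob_simplex, continuous vddag} &
        vddag nu != 0].

Definition admissible_rate (a : 'I_d) (vab : 'rV[R]_d -> R) : Prop :=
  (forall mu, prob_simplex mu -> vab mu = 0) \/
  ((forall mu, prob_simplex mu -> 0 < mu 0 a -> 0 < vab mu) /\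
   (forall nu, prob_simplex nu -> nu 0 a = 0 ->
      vab nu = 0 /\ rate_decomposition a vab nu)).

Definition jump_hamiltonian (v : 'I_d -> 'I_d -> 'rV[R]_d -> R)
    (mu p : 'rV[R]_d) : R :=
  \sum_a \sum_b v a b mu * (expR (p 0 b - p 0 a) - 1).

End viscosity.

Arguments prob_simplex : clear implicits.

(* Main.v *)
Require Import Defs.
From mathcomp Require Import all_boot all_order all_algebra.
From mathcomp Require Import all_classical all_reals all_analysis.
From mathcomp Require Import ring lra.
Import numFieldNormedType.Exports.
Local Open Scope classical_set_scope.
Local Open Scope ring_scope.

Set Implicit Arguments.
Unset Strict Implicit.
Unset Printing Implicit Defensive.
Import Order.TTheory GRing.Theory Num.Theory.

(* Doubling of variables with the one-sided penalty
   [penalty x y = \sum_a max(0, y_a - x_a)^2], which vanishes on the simplex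
   only for [x = y].  At a maximum of [u x - w y - al * penalty x y] both test
   functions have the same gradient [p], [p_a = - 2 al max(0, y_a - x_a)], so
   [u x - w y <= h x - h y + lambda (H(x, p) - H(y, p))].  In the (a, b) term,
   [exp (p_b - p_a)] can exceed 1 only when [x_a < y_a]; the decomposition of
   the rates then gives [v x <= (1 + o(1)) v y], while the supersolution
   inequality bounds [v y * exp (p_b - p_a)].  No subsequence is extracted as
   [al] grows: by compactness (near-covering), it suffices to exclude maximisers
   near each fixed pair of points. *)

(** * Calculus of the squared positive part and of separable functions *)

Lemma is_derive_sqr_max0 (R : realType) (t : R) :
  is_derive t 1 (fun s => (Num.max 0 s) ^+ 2) (2 * Num.max 0 t).
Proof.
have H : (fun h : R => h^-1 *:
    (((fun s => Num.max 0 s ^+ 2) \o shift t) (h *: 1) - Num.max 0 t ^+ 2))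
    @ 0^' --> 2 * Num.max 0 t.
  apply/cvgrPdist_le => e e0.
  near=> h.
  have h0 : h != 0 by near: h; exact: nbhs_dnbhs_neq.
  have he : `|h| <= e.
    by near: h; apply: dnbhs0_le.
  rewrite /= /shift /= [h *: 1]mulr1 [_ *: _]mulrC.
  have -> : 2 * Num.max 0 t - (Num.max 0 (h + t) ^+ 2 - Num.max 0 t ^+ 2) / h
    = (2 * Num.max 0 t * h - (Num.max 0 (h + t) ^+ 2 - Num.max 0 t ^+ 2)) / h.
    by field.
  rewrite normrM normfV ler_pdivrMr ?normr_gt0//.
  (* The derivative [2 * Num.max 0 t] is 2-Lipschitz, so the first-order Taylor remainder is at most
     [h ^+ 2]; the sign cases below check this directly. *)
  apply: (@le_trans _ _ (`|h| * `|h|)); last by rewrite ler_wpM2r.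
  have hh : 0 <= h * h by rewrite -expr2 sqr_ge0.
  rewrite -normrM [`|h * h|]ger0_norm// ler_norml.
  by case: (leP 0 (h + t)) => ?; case: (leP 0 t) => ?; apply/andP; split; nra.
split; first by apply/cvg_ex; exists (2 * Num.max 0 t).
exact: cvg_lim.
Unshelve. all: by end_near. Qed.

Lemma cvg_rV (R : numFieldType) (n : nat) (I : Type)
    (F : set_system I) (FF : Filter F) (f : I -> 'rV[R]_n) (l : 'rV[R]_n) :
  (forall i, f z 0 i @[z --> F] --> l 0 i) -> f @ F --> l.
Proof.
move=> fl A [P lP PA].
have : \forall z \near F, forall i, P 0 i (f z 0 i).
  by apply: filter_forall => i; apply: fl; apply: lP.
by apply: filterS => z Pz; apply: PA => i j; rewrite ord1.
Qed.

Section separable.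
Variables (R : realType) (n : nat) (F G : 'I_n -> R -> R).
Hypothesis dF : forall i (t : R), is_derive t 1 (F i) (G i t).

Lemma differentiable_separable (x : 'rV[R]_n) :
  differentiable (fun z : 'rV[R]_n => \sum_i F i (z 0 i)) x.
Proof.
have -> : (fun z : 'rV[R]_n => \sum_i F i (z 0 i)) =
    \sum_i (F i \o (fun z : 'rV[R]_n => z 0 i)).
  by apply/funext => z; rewrite fct_sumE.
apply: differentiable_sum => i; apply: differentiable_comp.
  exact: differentiable_coord.
by apply/derivable1_diffP; case: (dF i (x 0 i)).
Qed.

Lemma gradient_separable (x : 'rV[R]_n) :
  gradient (fun z : 'rV[R]_n => \sum_i F i (z 0 i)) x = \row_i G i (x 0 i).
Proof.
apply/rowP => i; rewrite !mxE.
have eqq (h : R) : \sum_j F j ((h *: delta_mx 0 i + x) 0 j) -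
    \sum_j F j (x 0 j) = F i (h *: 1 + x 0 i) - F i (x 0 i).
  rewrite (bigD1 i)//= [X in _ - X](bigD1 i)//= !mxE !eqxx.
  rewrite (eq_bigr (fun j => F j (x 0 j))); last first.
    by move=> j ji; rewrite !mxE (negbTE ji) andbF mulr0 add0r.
  by rewrite /GRing.scale /=; lra.
rewrite /derive (_ : (fun h => _) =
  (fun h => h^-1 *: ((F i \o shift (x 0 i)) (h *: 1) - F i (x 0 i)))).
  exact: (derive_val (is_derive := dF i (x 0 i))).
by apply/funext => h /=; rewrite eqq.
Qed.

Lemma C1_near_separable (E : set 'rV[R]_n) : (forall i, continuous (G i)) ->
  C1_near E (fun z : 'rV[R]_n => \sum_i F i (z 0 i)).
Proof.
move=> cG; exists setT; split => //; first exact: openT.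
  by move=> x _; exact: differentiable_separable.
move=> x _; rewrite (_ : gradient _ = fun z => \row_i G i (z 0 i)).
  apply: (@cvg_rV _ _ _ (nbhs x) (nbhs_filter x)) => i.
  under eq_fun do rewrite mxE; rewrite mxE.
  apply: continuous_comp; [exact: coord_continuous|exact: cG].
by apply/funext => z; rewrite gradient_separable.
Qed.

End separable.

(** * Maxima of upper semicontinuous functions on compact sets *)

Lemma usc_compact_max (T : topologicalType) (R : realType) (K : set T)
    (f : T -> R) : compact K -> K !=set0 ->
  (forall x c, K x -> f x < c -> \forall y \near x, K y -> f y < c) ->
  exists2 x, K x & forall y, K y -> f y <= f x.
Proof.
move=> cK [x0 Kx0] fusc; apply: contrapT => nomax.
have above x : K x -> exists2 y, K y & f x < f y.
  move=> Kx; apply: contrapT => nabove; apply: nomax; exists x => // y Ky.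
  by rewrite leNgt; apply/negP => fxy; apply: nabove; exists y.
(* If no point is a maximum, tails of [f] along [K] form a filter on which
   [f] eventually exceeds [f x], locally uniformly in [x]. *)
pose F := filter_from K (fun y => [set z | K z /\ f y <= f z]).
have FF : Filter F.
  apply: filter_from_filter; first by exists x0.
  move=> y1 y2 Ky1 Ky2; have [y12|/ltW y21] := leP (f y1) (f y2).
    by exists y2 => // z [Kz y2z]; split; split => //; exact: le_trans y2z.
  by exists y1 => // z [Kz y1z]; split; split => //; exact: le_trans y1z.
(* Near-covering makes the local bounds uniform: the tail above some [y] in [K] exceeds [f] on all
   of [K]. Since [y] lies in its own tail, [f y < f y]. *)
have [|y Ky /(_ y (conj Ky (lexx _)) y Ky)] :=
  (iffLR (compact_near_coveringP K) cK) T F (fun z x => K x -> f x < f z) FF.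
  move=> x Kx; have [y Ky fxy] := above x Kx.
  exists ([set x' | K x' -> f x' < f y], [set z | K z /\ f y <= f z]).
    by split; [exact: fusc|exists y].
  by move=> [x' z] [/= x'y [Kz yz]] Kx'; exact: lt_le_trans (x'y Kx') yz.
by move=> /(_ Ky); rewrite ltxx.
Qed.

(** * Local estimates for a single rate *)

Lemma near_fst_snd (T : topologicalType) (z : T) (P : T -> Prop) :
  (\forall x \near z, P x) -> \forall xy \near (z, z), P xy.1 /\ P xy.2.
Proof. by move=> Pz; exists (P, P) => // -[x y]. Qed.

Lemma within_continuous_dist (T : topologicalType) (R : realType) (E : set T)
    (f : T -> R) (z : T) (e : R) :
  {within E, continuous f} -> E z -> 0 < e ->
  \forall x \near z, E x -> `|f x - f z| < e.
Proof.
move=> /subspace_continuousP fc Ez e0.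
by have /cvgr_distC_lt/(_ e e0) := fc z Ez.
Qed.

Lemma near_ratio_le (R : realFieldType) (c eta : R) : 0 < c -> 0 < eta ->
  exists2 k, 0 < k & forall X Y, `|X - c| < k -> `|Y - c| < k ->
    0 < X /\ X <= (1 + eta) * Y.
Proof.
move=> c0 eta0; have [k1 k2] : c * Num.min 2^-1 (eta / 4) <= c / 2 /\
    c * Num.min 2^-1 (eta / 4) <= c * (eta / 4).
  by rewrite !ler_pM2l// !ge_min !lexx orbT.
(* The bound [c / 2] gives [Y > c / 2], and [c * (eta / 4)] gives [X - Y < eta * (c / 2)]. *)
exists (c * Num.min 2^-1 (eta / 4)).
  by rewrite mulr_gt0// lt_min invr_gt0 ltr0n divr_gt0.
move=> X Y; rewrite !ltr_norml => /andP[X1 X2] /andP[Y1 Y2]; split; first lra.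
have : eta * (c / 2) <= eta * Y by rewrite ler_pM2l//; lra.
lra.
Qed.

Section rate.
Variables (R : realType) (d : nat) (a : 'I_d) (vab : 'rV[R]_d -> R).
Local Notation E := (prob_simplex R d).
Hypothesis (v_cont : {within E, continuous vab}).

Lemma rate_quasi_monotone_interior (z : 'rV[R]_d) (eta : R) :
  E z -> 0 < vab z -> 0 < eta ->
  \forall xy \near (z, z), E xy.1 -> E xy.2 ->
    vab xy.1 <= (1 + eta) * vab xy.2.
Proof.
move=> Ez vz /(near_ratio_le vz)[k k0 ratio].
have := near_fst_snd (within_continuous_dist v_cont Ez k0).
apply: filterS => -[x y] /= [xz yz] Ex Ey.
by have [] := ratio _ _ (xz Ex) (yz Ey).
Qed.

(** Where the rate vanishes, continuity does not control ratios. The order of the coordinates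
    handles the monotone factor, and the nonvanishing factor alone costs [1 + eta]. *)
Lemma rate_quasi_monotone_boundary (z : 'rV[R]_d) (eta : R) :
  E z -> z 0 a = 0 -> vab z = 0 ->
  (forall mu, E mu -> 0 < mu 0 a -> 0 < vab mu) ->
  rate_decomposition a vab z -> 0 < eta ->
  \forall xy \near (z, z), E xy.1 -> E xy.2 -> xy.1 0 a < xy.2 0 a ->
    vab xy.1 <= (1 + eta) * vab xy.2.
Proof.
move=> Ez za0 vz0 vpos [U [g [D [Uz vE g_homo Dc Dz]]]] eta0.
have UEz : (U `&` E) z by split => //; exact: nbhs_singleton.
(* [v] vanishes at [z], hence so does the monotone factor [g]: this makes [g]
   nonnegative nearby and forces the sign of [D]. *)
have gz0 : g (z 0 a) = 0.
  by have /esym/eqP := vE z UEz; rewrite vz0 mulf_eq0 (negbTE Dz) orbF => /eqP.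
have Dz_gt0 : 0 < `|D z| by rewrite normr_gt0.
have [k k0 ratio] := near_ratio_le Dz_gt0 eta0.
(* Radius [k] controls the ratio of values of [D]; radius [|D z|] keeps the sign of [D] constant
   near [z]. *)
have kD0 : 0 < Num.min k `|D z| by rewrite lt_min k0.
have nbz : \forall x \near z, U x /\
    ((U `&` E) x -> `|D x - D z| < Num.min k `|D z|).
  exact: filterI Uz (within_continuous_dist Dc UEz kD0).
apply: filterS (near_fst_snd nbz) => -[x y] /= [[Ux Dx] [Uy Dy]] Ex Ey xy.
have {}Dx := Dx (conj Ux Ex); have {}Dy := Dy (conj Uy Ey).
have inS mu : U mu -> E mu -> mu 0 a \in [set mu 0 a | mu in U `&` E].
  by move=> Umu Emu; rewrite inE; exists mu.
have x0 : 0 <= x 0 a by case: Ex.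
have vy0 : 0 < vab y by apply: vpos => //; exact: le_lt_trans xy.
have gx0 : 0 <= g (x 0 a).
  by rewrite -gz0; apply: g_homo; rewrite ?inS ?za0//; case: UEz.
have gxy : g (x 0 a) <= g (y 0 a) by apply: g_homo; rewrite ?inS//; exact: ltW.
move: vy0; rewrite (vE y (conj Uy Ey)) (vE x (conj Ux Ex)) => vy0.
have gy0 : 0 < g (y 0 a).
  rewrite lt_neqAle (le_trans gx0)// andbT; apply/eqP => gy0.
  by rewrite -gy0 mul0r ltxx in vy0.
have Dy0 : 0 < D y by rewrite -(pmulr_rgt0 _ gy0).
move: Dx Dy; rewrite !lt_min => /andP[Dx _] /andP[Dy Dyz].
have Dz0 : 0 < D z.
  rewrite lt_neqAle eq_sym Dz leNgt; apply/negP => Dz_lt0.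
  by move: Dyz; rewrite ltr_norml (ltr0_norm Dz_lt0) => /andP[_]; lra.
rewrite (gtr0_norm Dz0) in ratio; have [Dx0 Dxy] := ratio _ _ Dx Dy.
apply: (@le_trans _ _ (g (y 0 a) * D x)); first by rewrite ler_wpM2r// ltW.
by rewrite mulrCA ler_wpM2l// ltW.
Qed.

(** Write [vx], [vy] for the two rates, which differ by less than [eps / 2] near [z]. If [t <= 0],
    the other factor is at most 1 in absolute value. Otherwise split the product as
    [(vx - vy) * expR t + (vy - vx)]; quasi-monotonicity bounds the first summand by
    [eta * vy * expR t <= eta * C]. *)
Lemma rate_jump_le (z : 'rV[R]_d) (C eps : R) :
  admissible_rate a vab -> E z -> 0 < eps ->
  \forall xy \near (z, z), E xy.1 -> E xy.2 -> forall t : R,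
    (xy.2 0 a <= xy.1 0 a -> t <= 0) -> vab xy.2 * expR t <= C ->
    (vab xy.1 - vab xy.2) * (expR t - 1) <= eps.
Proof.
move=> adm Ez eps0; case: adm => [v0|[vpos vbd]].
  apply: (@filterE _ (nbhs (z, z))) => -[x y] /= Ex Ey t _ _.
  by rewrite !v0// subrr mul0r ltW.
pose eta := eps / 2 / (`|C| + 1).
have C1 : 0 < `|C| + 1 by rewrite ltr_wpDl.
have eta0 : 0 < eta by rewrite !divr_gt0.
have etaC : eta * C <= eps / 2.
  apply: (@le_trans _ _ (eta * (`|C| + 1))); last by rewrite divfK ?gt_eqF.
  by rewrite ler_pM2l// (le_trans (ler_norm C))// lerDl.
have quasi : \forall xy \near (z, z), E xy.1 -> E xy.2 -> xy.1 0 a < xy.2 0 a ->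
    vab xy.1 <= (1 + eta) * vab xy.2.
  have [za|za] := ltP 0 (z 0 a).
    have := rate_quasi_monotone_interior Ez (vpos z Ez za) eta0.
    by apply: filterS => xy vxy Ex Ey _; exact: vxy.
  have za0 : z 0 a = 0 by apply/eqP; rewrite eq_le za; case: Ez => ->.
  by have [vz0 dec] := vbd z Ez za0; exact: rate_quasi_monotone_boundary.
have e4 : 0 < eps / 4 by rewrite divr_gt0.
have := near_fst_snd (within_continuous_dist v_cont Ez e4).
apply: filter_app; apply: filterS quasi => -[x y] /= qxy [xz yz] Ex Ey t tle vC.
have et := expR_gt0 t.
move: (xz Ex) (yz Ey); rewrite !ltr_norml => /andP[x1 x2] /andP[y1 y2].
have [yx|xy] := leP (y 0 a) (x 0 a).
  have : expR t <= 1 by rewrite -expR0 ler_expR tle.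
  nra.
have {}qxy := qxy Ex Ey xy.
have : eta * (vab y * expR t) <= eta * C by rewrite ler_pM2l.
nra.
Qed.

End rate.

(** * Difference of the Hamiltonian at two nearby points *)

Section hamiltonian.
Variables (R : realType) (d : nat) (v : 'I_d -> 'I_d -> 'rV[R]_d -> R).
Local Notation E := (prob_simplex R d).
Hypotheses (v_ge0 : forall a b mu, E mu -> 0 <= v a b mu)
           (v_cont : forall a b, {within E, continuous (v a b)})
           (v_adm : forall a b, admissible_rate a (v a b)).

(* The sign constraints on [p] are those of the gradient of the penalty; the
   bound on [H y p] is what the supersolution inequality provides. *)
Lemma jump_hamiltonian_diff_le (z : 'rV[R]_d) (C eps : R) :
  E z -> 0 < eps ->
  \forall xy \near (z, z), E xy.1 -> E xy.2 -> forall p : 'rV[R]_d,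
    (forall a, p 0 a <= 0) ->
    (forall a, xy.2 0 a <= xy.1 0 a -> p 0 a = 0) ->
    jump_hamiltonian v xy.2 p <= C ->
    jump_hamiltonian v xy.1 p - jump_hamiltonian v xy.2 p <= eps.
Proof.
move=> Ez eps0.
(* Adding the total rate at [y] to [H y p] leaves the sum of the nonnegative terms
   [v a b y * expR (p_b - p_a)]. Hence [C'] bounds each of them once every rate at [y] exceeds its
   value at [z] by at most 1. *)
pose C' := C + \sum_a \sum_b (v a b z + 1).
pose e := eps / (d * d).+1%:R.
have e0 : 0 < e by rewrite divr_gt0.
have vz : \forall xy \near (z, z), forall a b, E xy.2 ->
    v a b xy.2 <= v a b z + 1.
  apply: (filter_forall (F := nbhs (z, z))) => a.
  apply: (filter_forall (F := nbhs (z, z))) => b.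
  have := near_fst_snd (within_continuous_dist (@v_cont a b) Ez ltr01).
  apply: (filterS (F := nbhs (z, z))) => -[x y] /= [_ yz] /yz.
  by rewrite ltr_norml => /andP[_]; lra.
have jump : \forall xy \near (z, z), forall a b, E xy.1 -> E xy.2 ->
    forall t : R,
    (xy.2 0 a <= xy.1 0 a -> t <= 0) -> v a b xy.2 * expR t <= C' ->
    (v a b xy.1 - v a b xy.2) * (expR t - 1) <= e.
  apply: (filter_forall (F := nbhs (z, z))) => a.
  apply: (filter_forall (F := nbhs (z, z))) => b.
  exact: (rate_jump_le (@v_cont a b)).
apply: filter_app vz; apply: filterS jump.
move=> -[x y] /= jump vz Ex Ey p p_le0 p0 HC.
pose w a b := v a b y * expR (p 0 b - p 0 a).
have w0 a b : 0 <= w a b by rewrite mulr_ge0 ?v_ge0 ?expR_ge0.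
have sumw : \sum_a \sum_b w a b <= C'.
  have -> : \sum_a \sum_b w a b =
      jump_hamiltonian v y p + \sum_a \sum_b v a b y.
    rewrite -big_split; apply: eq_bigr => a _; rewrite -big_split.
    by apply: eq_bigr => b _ /=; rewrite /w; ring.
  by apply: lerD => //; apply: ler_sum => a _; apply: ler_sum => b _; exact: vz.
have wC a b : w a b <= C'.
  apply: le_trans sumw; rewrite (bigD1 a)//= (bigD1 b)//= -addrA lerDl.
  by rewrite addr_ge0// !sumr_ge0// => i _; rewrite sumr_ge0.
rewrite -sumrB; apply: (@le_trans _ _ (\sum_(a < d) \sum_(b < d) e)).
  apply: ler_sum => a _; rewrite -sumrB; apply: ler_sum => b _.
  (* If [y_a <= x_a] then [p_a = 0], so the exponent [p_b - p_a] is just [p_b <= 0]. *)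
  rewrite -mulrBl; apply: jump => //; last exact: wC.
  by move=> /p0 ->; rewrite subr0.
rewrite !sumr_const card_ord -mulrnA -mulr_natr /e -mulrA.
rewrite ler_piMr ?(ltW eps0)//.
by rewrite mulrC ler_pdivrMr// mul1r ler_nat.
Qed.

End hamiltonian.

(** * The simplex, the penalty and the test functions *)

Section simplex.
Variables (R : realType) (d : nat).
Local Notation E := (prob_simplex R d).

Lemma prob_simplex_compact : compact E.
Proof.
have cK : compact [set x : 'rV[R]_d | forall i, `[0%R, 1%R]%classic (x ord0 i)].
  apply: (@rV_compact R d (fun=> `[0, 1]%classic)) => _.
  exact: segment_compact.
apply: subclosed_compact cK _; last first.
  move=> x [x0 x1] i /=; rewrite in_itv /= x0 -x1 (bigD1 i)//= lerDl.
  by rewrite sumr_ge0.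
have -> : E = \bigcap_i [set x : 'rV[R]_d | 0 <= x 0 i] `&`
    [set x | \sum_i x 0 i = 1].
  apply/seteqP; split => x [x0 x1]; split => // i; first by move=> _; exact: x0.
  exact: x0.
apply: closedI.
  apply: closed_bigI => i _.
  apply: (preimage_closed (f := fun x : 'rV[R]_d => x 0 i) _ (@closed_ge R 0)).
  by move=> x _; exact: coord_continuous.
apply: (preimage_closed (f := fun x : 'rV[R]_d => \sum_i x 0 i)
  _ (@closed_eq R 1)) => x _.
apply: continuous_big => [|i _]; first exact: add_continuous.
exact: coord_continuous.
Qed.

Definition penalty (x y : 'rV[R]_d) : R :=
  \sum_a Num.max 0 (y 0 a - x 0 a) ^+ 2.

Lemma penalty_ge0 x y : 0 <= penalty x y.
Proof. by rewrite sumr_ge0// => a _; rewrite sqr_ge0. Qed.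

Lemma penaltyxx x : penalty x x = 0.
Proof. by rewrite /penalty big1// => a _; rewrite subrr maxxx expr0n. Qed.

(* A one-sided penalty separates points because coordinates sum to [1]. *)
Lemma penalty_gt0 x y : E x -> E y -> x != y -> 0 < penalty x y.
Proof.
move=> [_ x1] [_ y1] xy; rewrite lt_neqAle penalty_ge0 andbT eq_sym.
apply: contraNneq xy => pen0.
have yx a : 0 <= x 0 a - y 0 a.
  have /eqP : Num.max 0 (y 0 a - x 0 a) ^+ 2 = 0.
    by apply: (psumr_eq0P _ pen0) => // i _; rewrite sqr_ge0.
  rewrite sqrf_eq0 => /eqP m0; rewrite -oppr_le0 opprB -m0.
  by rewrite le_max lexx orbT.
apply/eqP/rowP => a; apply/eqP; rewrite -subr_eq0.
have s0 : \sum_i (x 0 i - y 0 i) = 0 by rewrite sumrB x1 y1 subrr.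
by rewrite (psumr_eq0P (fun i _ => yx i) s0).
Qed.

Lemma continuous_max0 (T : topologicalType) (g : T -> R) :
  continuous g -> continuous (fun t => Num.max 0 (g t)).
Proof.
move=> cg t; apply: (@continuous_max _ _ (fun=> 0) g); last exact: cg.
exact: cvg_cst.
Qed.

Lemma continuous_penalty :
  continuous (fun xy : 'rV[R]_d * 'rV[R]_d => penalty xy.1 xy.2).
Proof.
apply: continuous_big => [|a _]; first exact: add_continuous.
have cmax : continuous (fun xy : 'rV[R]_d * 'rV[R]_d =>
    Num.max 0 (xy.2 0 a - xy.1 0 a)).
  apply: continuous_max0 => xy; apply: cvgB.
    apply: (@cvg_comp _ _ _ snd (fun z : 'rV[R]_d => z 0 a)).
      exact: cvg_snd.
    exact: coord_continuous.
  apply: (@cvg_comp _ _ _ fst (fun z : 'rV[R]_d => z 0 a)).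
    exact: cvg_fst.
  exact: coord_continuous.
by move=> xy; exact: cvgM (cmax xy) (cmax xy).
Qed.

Section quadratic.
Variables (c s : R) (k : 'rV[R]_d).
(** One form for both test functions: [c = al], [s = -1] gives the penalty in its first argument,
    and [c = - al], [s = 1] gives its negative in the second. *)
Let q (z : 'rV[R]_d) := c * \sum_a Num.max 0 (s * (z 0 a - k 0 a)) ^+ 2.
Let F a (t : R) := c * Num.max 0 (s * (t - k 0 a)) ^+ 2.
Let G a (t : R) := c * (2 * Num.max 0 (s * (t - k 0 a)) * s).

Let dF a (t : R) : is_derive t 1 (F a) (G a t).
Proof.
have dl : is_derive t (1 : R) (s *: (id - cst (k 0 a))) s.
  by apply: is_derive_eq; rewrite subr0 [_ *: _]mulr1.
exact/is_deriveZ/(is_derive1_comp (is_derive_sqr_max0 _) dl).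
Qed.

Let qE : q = fun z => \sum_a F a (z 0 a).
Proof. by apply/funext => z; rewrite /q mulr_sumr. Qed.

Lemma C1_near_quadratic (A : set 'rV[R]_d) : C1_near A q.
Proof.
have cmax a : continuous (fun t => Num.max 0 (s * (t - k 0 a))).
  apply: continuous_max0 => t; apply: cvgM; first exact: cvg_cst.
  by apply: cvgB; [exact: cvg_id|exact: cvg_cst].
rewrite qE; apply: (C1_near_separable dF) => a t.
apply: cvgM; first exact: cvg_cst.
apply: cvgM; last exact: cvg_cst.
by apply: cvgM; [exact: cvg_cst|exact: cmax].
Qed.

Lemma gradient_quadratic z :
  gradient q z = \row_a (c * (2 * Num.max 0 (s * (z 0 a - k 0 a)) * s)).
Proof. by rewrite qE (gradient_separable dF). Qed.

End quadratic.

End simplex.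

(** * Semicontinuity of the penalised difference *)

Lemma near_within_subspace (T : topologicalType) (A : set T) (x : T)
    (P : T -> Prop) :
  A x -> (exists2 V, nbhs (x : subspace A) V & forall y, V y -> P y) ->
  \forall y \near x, A y -> P y.
Proof.
move=> Ax [V]; rewrite {1}/nbhs/= -nbhs_subspace_in// => xV VP.
by move: xV; apply: (filterS (F := nbhs x)) => y Vy Ay; exact: VP (Vy Ay).
Qed.

Lemma usc_penalized (R : realType) (T U : topologicalType)
    (A : set T) (B : set U) (u : T -> R) (w : U -> R) (g : T * U -> R) :
  upper_semicontinuous (fun x : subspace A => (u x)%:E) ->
  lower_semicontinuous (fun x : subspace B => (w x)%:E) ->
  continuous g ->
  forall xy c, (A `*` B) xy -> u xy.1 - w xy.2 - g xy < c ->
  \forall xy' \near xy, (A `*` B) xy' -> u xy'.1 - w xy'.2 - g xy' < c.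
Proof.
move=> uusc wlsc gc [x y] c [/= Ax By] lt_c.
(* A third of the gap for each of [u], [w] and [g]. *)
pose e := (c - (u x - w y - g (x, y))) / 3.
have e0 : 0 < e by rewrite divr_gt0// subr_gt0.
have ux : \forall x' \near x, A x' -> u x' < u x + e.
  apply: near_within_subspace => //.
  have [|V xV VP] := uusc x (u x + e); first by rewrite lte_fin ltrDl.
  by exists V.
have wy : \forall y' \near y, B y' -> w y - e < w y'.
  apply: near_within_subspace => //.
  have [|V xV VP] := wlsc y (w y - e); first by rewrite lte_fin gtrBl.
  by exists V.
have gxy : \forall xy' \near (x, y), `|g (x, y) - g xy'| < e.
  by have /cvgrPdist_lt/(_ e e0) := gc (x, y).
have uw : \forall xy' \near (x, y), (A `*` B) xy' ->
    u xy'.1 < u x + e /\ w y - e < w xy'.2.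
  exists ([set x' | A x' -> u x' < u x + e], [set y' | B y' -> w y - e < w y']).
    by split; [exact: ux|exact: wy].
  by move=> [x' y'] /= [ux' wy'] [/= /ux' ? /wy' ?].
apply: filter_app gxy; apply: filterS uw => -[x' y'] /= uw'.
rewrite ltr_norml => /andP[_ g'] AB'; have [u' w'] := uw' AB'.
have e3 : 3 * e = c - (u x - w y - g (x, y)) by rewrite /e; field.
lra.
Qed.

(** * Doubling of variables and comparison *)

Theorem theorem2p7 (R : realType) (d : nat) (d_ge1 : (1 <= d)%N)
  (v : 'I_d -> 'I_d -> 'rV[R]_d -> R)
  (v_ge0 : forall a b mu, prob_simplex R d mu -> 0 <= v a b mu)
  (v_cont : forall a b, {within prob_simplex R d, continuous (v a b)})
  (v_adm : forall a b, admissible_rate a (v a b))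
  (lambda : R) (lambda_gt0 : 0 < lambda)
  (h : 'rV[R]_d -> R) (h_cont : {within prob_simplex R d, continuous h}) :
  comparison_principle (prob_simplex R d) (jump_hamiltonian v) lambda h.
Proof.
move=> u w [[Bu [_ uB]] uusc usub] [[Bw [_ wB]] wlsc wsup] x0 Ex0.
rewrite leNgt; apply/negP => wu0.
set E := prob_simplex R d in uB wB uusc wlsc usub wsup Ex0 *.
pose M := u x0 - w x0; have M0 : 0 < M by rewrite subr_gt0.
(* Boundedness supplies estimates only for constants strictly above [Bu] and [Bw], whence the
   [+ 1]. *)
pose B := `|Bu| + `|Bw| + 1.
have uleB x : E x -> `|u x| <= B.
  apply: uB; rewrite (le_lt_trans (ler_norm _))// /B.
  by have := normr_ge0 Bw; lra.
have wleB x : E x -> `|w x| <= B.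
  apply: wB; rewrite (le_lt_trans (ler_norm _))// /B.
  by have := normr_ge0 Bu; lra.
pose Phi al (xy : 'rV[R]_d * 'rV[R]_d) :=
  u xy.1 - w xy.2 - al * penalty xy.1 xy.2.
have cEE : compact (E `*` E).
  by apply: compact_setX; exact: prob_simplex_compact.
have maxPhi al : exists2 xy, (E `*` E) xy &
    forall xy', (E `*` E) xy' -> Phi al xy' <= Phi al xy.
  apply: usc_compact_max => //; first by exists (x0, x0).
  apply: usc_penalized => // xy.
  by apply: cvgM; [exact: cvg_cst|exact: continuous_penalty].
(* The penalty vanishes on the diagonal, so every maximum is at least the value [M] at
   [(x0, x0)]. *)
have maxM al xy : (forall xy', (E `*` E) xy' -> Phi al xy' <= Phi al xy) ->
    M <= Phi al xy.
  by move=> /(_ (x0, x0) (conj Ex0 Ex0)); rewrite /Phi /= penaltyxx mulr0 subr0.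
suff : \forall al \near +oo, (E `*` E) `<=` [set xy |
    ~ ((E `*` E) xy /\ forall xy', (E `*` E) xy' -> Phi al xy' <= Phi al xy)].
  move=> /filter_ex[al nomax]; have [xy Exy xymax] := maxPhi al.
  exact: (nomax xy).
apply: (iffLR (compact_near_coveringP _) cEE) => -[xb yb] [/= Exb Eyb].
have [<-{yb Eyb}|xyb] := eqVneq xb yb; last first.
  (* Off the diagonal the penalty stays above half its value at [(xb, yb)]. For [al] above [4 * B]
     over that value, the penalty term exceeds [2 * B], hence [u - w], and [Phi] falls below
     [0 < M]. *)
  have pen0 := penalty_gt0 Exb Eyb xyb.
  have pen_near : \forall xy \near (xb, yb),
      penalty xb yb / 2 < penalty xy.1 xy.2.
    have /cvgrPdist_lt/(_ _ (divr_gt0 pen0 (ltr0Sn _ 1))) :=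
      @continuous_penalty R d (xb, yb).
    by apply: filterS => xy; rewrite ltr_norml => /andP[_] /=; lra.
  have al_near : \forall al \near +oo, 4 * B / penalty xb yb < al.
    by apply: nbhs_pinfty_gt; exact: num_real.
  exists ([set xy | penalty xb yb / 2 < penalty xy.1 xy.2],
          [set al | 4 * B / penalty xb yb < al]) => // -[[x y] al] /= [pxy].
  rewrite ltr_pdivrMr// => alB [[/= Ex Ey] /maxM]; rewrite /Phi /= => MPhi.
  have := uleB _ Ex; have := wleB _ Ey.
  rewrite !ler_norml => /andP[w1 _] /andP[_ u1].
  have B0 : 0 < B.
    by rewrite /B; have := normr_ge0 Bu; have := normr_ge0 Bw; lra.
  have al0 : 0 < al by rewrite -(pmulr_lgt0 _ pen0); lra.
  have : al * (penalty xb yb / 2) < al * penalty x y by rewrite ltr_pM2l.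
  lra.
rename xb into z; rename Exb into Ez.
(* Error budget on the diagonal: [h x - h y] costs less than [M / 2] and the scaled Hamiltonian
   difference at most [M / 4], in total less than [M]. *)
have M4 : 0 < M / 4 by rewrite divr_gt0.
(* The supersolution inequality gives [lambda * H y p <= w y - h y], and [h y] is within [M / 4] of
   [h z]. *)
pose C := (B + `|h z| + M) / lambda.
have hz := near_fst_snd (within_continuous_dist h_cont Ez M4).
have Hz := jump_hamiltonian_diff_le v_ge0 v_cont v_adm C Ez
  (divr_gt0 M4 lambda_gt0).
near=> xy al => /= -[[Ex Ey] xymax].
have [//|hx hy] := near hz xy.
have Hxy := near Hz xy.
have al0 : 0 < al by near: al; exact: nbhs_pinfty_gt.
have Mxy := maxM _ _ xymax.
set x := xy.1 in Ex hx Mxy Hxy *; set y := xy.2 in Ey hy Mxy Hxy *.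
(* The penalty depends only on [y - x], so its two partial gradients are opposite; the sign of the
   second test function makes both gradients equal to [p]. *)
pose p : 'rV[R]_d := \row_a (- (2 * al * Num.max 0 (y 0 a - x 0 a))).
have fxE : (fun x' => al * penalty x' y) =
    fun x' => al * \sum_a Num.max 0 (- 1 * (x' 0 a - y 0 a)) ^+ 2.
  apply/funext => x'; congr (_ * _); apply: eq_bigr => a _.
  by rewrite mulN1r opprB.
have fyE : (fun y' => - al * penalty x y') =
    fun y' => - al * \sum_a Num.max 0 (1 * (y' 0 a - x 0 a)) ^+ 2.
  by apply/funext => y'; congr (_ * _); apply: eq_bigr => a _; rewrite mul1r.
have gx : gradient (fun x' => al * penalty x' y) x = p.
  rewrite fxE gradient_quadratic; apply/rowP => a; rewrite !mxE.
  by rewrite mulN1r opprB; ring.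
have gy : gradient (fun y' => - al * penalty x y') y = p.
  rewrite fyE gradient_quadratic; apply/rowP => a; rewrite !mxE.
  by rewrite mul1r; ring.
have sub : u x - lambda * jump_hamiltonian v x p - h x <= 0.
  rewrite -gx; apply: usub => //.
    by rewrite fxE; exact: C1_near_quadratic.
  move=> x' Ex'; have := xymax (x', xy.2) (conj Ex' Ey).
  by rewrite /Phi /= -/x -/y; lra.
have sup : 0 <= w y - lambda * jump_hamiltonian v y p - h y.
  rewrite -gy; apply: wsup => //.
    by rewrite fyE; exact: C1_near_quadratic.
  move=> y' Ey'; have := xymax (xy.1, y') (conj Ex Ey').
  by rewrite /Phi /= -/x -/y; lra.
have wB' := le_trans (ler_norm _) (wleB _ Ey).
have := ler_norm (- h z); rewrite normrN => hzN.
move: (hx Ex) (hy Ey); rewrite !ltr_norml => /andP[_ hx'] /andP[hy' _].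
have HC : jump_hamiltonian v y p <= C.
  by rewrite /C ler_pdivlMr// mulrC; lra.
have p_le0 a : p 0 a <= 0.
  by rewrite mxE oppr_le0 !mulr_ge0 ?(ltW al0)// le_max lexx.
have p0 a : y 0 a <= x 0 a -> p 0 a = 0.
  by move=> yx; rewrite mxE max_l ?mulr0 ?oppr0// subr_le0.
have : jump_hamiltonian v x p - jump_hamiltonian v y p <= M / 4 / lambda.
  exact: Hxy.
rewrite ler_pdivlMr// => Hdiff.
have pen : 0 <= al * penalty x y by rewrite mulr_ge0 ?penalty_ge0// ltW.
by move: Mxy; rewrite /Phi /= -/x -/y; lra.
Unshelve. all: by end_near. Qed.
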